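(* Let $E$ be a representation of a Lie algebra $\mathfrak g\subset\mathfrak{gl}(E)$ preserving a non-degenerate reflexive form $\langle\cdot,\cdot\rangle$ and a direct sum decomposition $E=V_1\oplus V_2$ (i.e. $V_1,V_2$ are $\mathfrak g$-invariant). Let $W_1=V_1^\perp$, $W_2=V_2^\perp$, and let $F_e,F_\tau,\tilde F$ be the associated invariant subspaces. Then: (i) $E=F_e\oplus^\perp F_\tau\oplus^\perp\tilde F$ (mutually orthogonal direct sum); (ii) $F_e=F_e^+\oplus (F_e^+)^*$ as representations, for some totally isotropic sub-representation $F_e^+$ of $F_e$, where $(F_e^+)^*$ denotes the dual representation; (iii) $F_\tau=F_\tau^+\oplus^\perp F_\tau^-$ for some non-degenerate sub-representation $F_\tau^+$ of $F_\tau$ (with $F_\tau^-$ a sub-representation orthogonal to it); (iv) $\tilde F=\tilde F_0\otimes\mathbb K^2$ as representations, for some non-degenerate sub-representation $\tilde F_0$ of $\tilde F$, where $\mathbb K^2$ is the trivial representation.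
   Context: $\mathbb K$ is a commutative field of characteristic different from $2$ and $E$ is a finite-dimensional $\mathbb K$-vector space. A reflexive form is a symmetric or antisymmetric bilinear form. It is preserved by $\mathfrak g$ if $\langle ax,y\rangle+\langle x,ay\rangle=0$ for all $a\in\mathfrak g$, $x,y\in E$. A subspace $V$ is degenerate if $V\cap V^\perp\neq\{0\}$, non-degenerate otherwise, and totally isotropic if $V\subset V^\perp$. Given $E=V_1\oplus V_2=W_1\oplus W_2$: write $e$ for the identity and $\tau=(1\,2)$ for the transposition in $\mathcal S_2$. For $\sigma\in\mathcal S_2$ set $F_\sigma(0)=\{0\}$, $F_\sigma(n+1)=\sum_{i=1}^{2}\big((F_\sigma(n)+V_i)\cap(F_\sigma(n)+W_{\sigma(i)})\big)$, and $F_\sigma=\sum_n F_\sigma(n)$. Set $\tilde F(0)=E$, $\tilde F(n+1)=\bigcap_{i,j\in\{1,2\}}\big((\tilde F(n)\cap V_i)+(\tilde F(n)\cap W_j)\big)$, and $\tilde F=\bigcap_n\tilde F(n)$. (When $W_j=V_j^\perp$ and the form is non-degenerate, one indeed has $E=W_1\oplus W_2$.) *)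

(* Defs.v *)
(* A reflexive form on E is an element of {hermitian E for eps & idfun}, i.e. a
   bilinear form with <x, y> = (-1) ^+ eps * <y, x>: symmetric for eps = false,
   antisymmetric for eps = true. *)
From HB Require Import structures.
From mathcomp Require Import all_boot all_order all_fingroup all_algebra.
From mathcomp Require Export sesquilinear.

Set Implicit Arguments.
Unset Strict Implicit.
Unset Printing Implicit Defensive.

Import GRing.Theory.
Local Open Scope ring_scope.

(* directv is inferred from the syntactic form of its argument and would look
   inside subspaces that are themselves defined as sums (such as Fsum below);
   here the summands are variables. *)
Definition direct_sum3 (K : fieldType) (E : vectType K)
    (T U1 U2 U3 : {vspace E}) : Prop :=
  T = (U1 + U2 + U3)%VS /\ directv (U1 + U2 + U3).

Section Representations.
Variables (K : fieldType) (E : vectType K).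
Implicit Types (g : {vspace 'End(E)}) (U : {vspace E}) (V W : vectType K).

Definition lie_bracket V (a b : 'End(V)) : 'End(V) :=
  (a \o b)%VF - (b \o a)%VF.

Definition lie_subalgebra g : Prop :=
  {in g &, forall a b, lie_bracket a b \in g}.

Definition subrep g U : Prop := {in g, forall a : 'End(E), (a @: U <= U)%VS}.

(* A representation of g on V is carried by a map defined on all of 'End(E);
   only its values on g are meaningful. *)
Definition is_rep g V (rho : 'End(E) -> 'End(V)) : Prop :=
  {in g &, forall a b, forall k : K, rho (k *: a + b) = k *: rho a + rho b} /\
  {in g &, forall a b, rho (lie_bracket a b) = lie_bracket (rho a) (rho b)}.

Definition rep_iso g V W (rho : 'End(E) -> 'End(V)) (sigma : 'End(E) -> 'End(W))
    (phi : 'Hom(V, W)) : Prop :=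
  bijective phi /\ {in g, forall a, (phi \o rho a)%VF = (sigma a \o phi)%VF}.

(* vsproj U is a projection of E onto U, so when U is g-stable this is the
   restriction of a to U, see sub_actE. *)
Definition sub_act U (a : 'End(E)) : 'End(subvs_of U) :=
  linfun (vsproj U \o a \o vsval).

Definition triv_act V (a : 'End(E)) : 'End(V) := 0.

Definition dsum_fun V W (f : 'End(V)) (h : 'End(W)) (p : V * W) : V * W :=
  (f p.1, h p.2).

Fact dsum_fun_linear V W f h : linear (@dsum_fun V W f h).
Proof. by move=> k p q; rewrite /dsum_fun /= !linearP. Qed.
HB.instance Definition _ V W f h :=
  GRing.isLinear.Build K (V * W)%type (V * W)%type _ (@dsum_fun V W f h)
    (dsum_fun_linear f h).

Definition dsum_act V W (rho : 'End(E) -> 'End(V)) (sigma : 'End(E) -> 'End(W))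
  (a : 'End(E)) : 'End((V * W)%type) := linfun (dsum_fun (rho a) (sigma a)).

Definition dual V : vectType K := 'Hom(V, K^o).

Definition dual_fun V (f : 'End(V)) (l : dual V) : dual V := - (l \o f)%VF.

Fact dual_fun_linear V f : linear (@dual_fun V f).
Proof.
move=> k l m; apply/lfunP => v; rewrite /dual_fun.
by rewrite !(add_lfunE, opp_lfunE, scale_lfunE, comp_lfunE) opprD scalerN.
Qed.
HB.instance Definition _ V f :=
  GRing.isLinear.Build K (dual V) (dual V) _ (@dual_fun V f) (dual_fun_linear f).

Definition dual_act V (rho : 'End(E) -> 'End(V)) (a : 'End(E)) : 'End(dual V) :=
  linfun (dual_fun (rho a)).

(* V (x) W is modelled as Hom(W^*, V), v (x) w being l |-> l(w) v; this has the
   universal property of the tensor product, see tensorP. *)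
Definition tensor V W : vectType K := 'Hom(dual W, V).

Definition tmul_fun V W (v : V) (w : W) (l : dual W) : V := (l w : K) *: v.

Fact tmul_fun_linear V W v w : linear (@tmul_fun V W v w).
Proof. by move=> k l m; rewrite /tmul_fun lfunE /= lfunE /= scalerDl scalerA. Qed.
HB.instance Definition _ V W v w :=
  GRing.isLinear.Build K (dual W) V _ (@tmul_fun V W v w) (tmul_fun_linear v w).

Definition tmul V W (v : V) (w : W) : tensor V W := linfun (tmul_fun v w).

(* f (x) 1 + 1 (x) h; precomposition with l |-> l \o h is - dual_fun h. *)
Definition tensor_fun V W (f : 'End(V)) (h : 'End(W)) (T : tensor V W) :
  tensor V W := (f \o T)%VF - (T \o linfun (dual_fun h))%VF.

Fact tensor_fun_linear V W f h : linear (@tensor_fun V W f h).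
Proof.
move=> k S T; apply/lfunP => l; rewrite /tensor_fun.
rewrite !(add_lfunE, opp_lfunE, scale_lfunE, comp_lfunE) linearP /=.
by rewrite opprD addrACA scalerBr.
Qed.
HB.instance Definition _ V W f h :=
  GRing.isLinear.Build K (tensor V W) (tensor V W) _ (@tensor_fun V W f h)
    (tensor_fun_linear f h).

Definition tensor_act V W (rho : 'End(E) -> 'End(V))
    (sigma : 'End(E) -> 'End(W)) (a : 'End(E)) : 'End(tensor V W) :=
  linfun (tensor_fun (rho a) (sigma a)).

Lemma sub_actE g U a u : subrep g U -> a \in g ->
  vsval (sub_act U a u) = a (vsval u).
Proof.
move=> gU ga; rewrite lfunE /= vsprojK //.
by apply: (subvP (gU a ga)); rewrite memv_img ?subvsP.
Qed.

Lemma tmulE V W (v : V) (w : W) (l : dual W) : tmul v w l = (l w : K) *: v.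
Proof. by rewrite lfunE. Qed.

Lemma tensor_act_tmul V W rho sigma a (v : V) (w : W) :
  tensor_act rho sigma a (tmul v w) = tmul (rho a v) w + tmul v (sigma a w).
Proof.
apply/lfunP => l; rewrite lfunE /= /tensor_fun.
rewrite add_lfunE opp_lfunE !comp_lfunE add_lfunE !tmulE linearZ /=.
by rewrite lfunE /= /dual_fun opp_lfunE comp_lfunE scaleNr opprK.
Qed.

Lemma tensor_sum V W (T : tensor V W) (b := vbasis {:W}) :
  T = \sum_i tmul (T (linfun (coord b i : W -> K^o))) b`_i.
Proof.
apply/lfunP => l; rewrite sum_lfunE.
under eq_bigr => i _ do rewrite tmulE -linearZ.
rewrite -linear_sum; congr (T _); apply/lfunP => w.
rewrite sum_lfunE {1}(coord_vbasis (memvf w)) linear_sum; apply: eq_bigr => i _.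
by rewrite linearZ scale_lfunE lfunE; apply: mulrC.
Qed.

Lemma tensorP V W (X : vectType K) (B : {bilinear V -> W -> X}) :
  exists! L : 'Hom(tensor V W, X), forall v w, L (tmul v w) = B v w.
Proof.
pose b := vbasis {:W}; pose c i : dual W := linfun (coord b i : W -> K^o).
pose L0 (T : tensor V W) := \sum_i B (T (c i)) b`_i.
have L0lin : linear L0.
  move=> k S T; rewrite /L0 scaler_sumr -big_split; apply: eq_bigr => i _ /=.
  by rewrite add_lfunE scale_lfunE linearPl.
pose LL := GRing.isLinear.Build K (tensor V W) X _ L0 L0lin.
pose L1 : {linear tensor V W -> X} := HB.pack L0 LL.
exists (linfun L1); split=> [v w|L2 L2P].
  rewrite lfunE /= /L0 {2}(coord_vbasis (memvf w)) linear_sumr.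
  apply: eq_bigr => i _.
  by rewrite tmulE lfunE /= linearZl_LR linearZr.
apply/lfunP => T; rewrite lfunE {2}(tensor_sum T) linear_sum.
by apply: eq_bigr => i _; rewrite [RHS]L2P.
Qed.

Section IsRep.
Variable g : {vspace 'End(E)}.

Lemma sub_act_is_rep U : subrep g U -> is_rep g (sub_act U).
Proof.
move=> gU; split=> [a b ga gb k|a b ga gb]; apply/lfunP => u.
  by rewrite add_lfunE scale_lfunE !lfunE /= add_lfunE scale_lfunE linearP.
have Ua x c : c \in g -> x \in U -> c x \in U.
  by move=> gc xU; apply: (subvP (gU c gc)); rewrite memv_img.
rewrite /lie_bracket lfunE /= add_lfunE opp_lfunE !comp_lfunE.
rewrite add_lfunE opp_lfunE !comp_lfunE !lfunE /= linearB /=.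
by rewrite (vsprojK (Ua _ _ ga (subvsP u))) (vsprojK (Ua _ _ gb (subvsP u))).
Qed.

Lemma triv_act_is_rep V : is_rep g (@triv_act V).
Proof.
split=> a b _ _; first by move=> k; rewrite /triv_act scaler0 addr0.
by rewrite /lie_bracket /triv_act comp_lfun0l subrr.
Qed.

Variables (V W : vectType K).
Variables (rho : 'End(E) -> 'End(V)) (sigma : 'End(E) -> 'End(W)).
Hypotheses (rhoP : is_rep g rho) (sigmaP : is_rep g sigma).

Lemma dsum_act_is_rep : is_rep g (dsum_act rho sigma).
Proof.
case: rhoP sigmaP => [rL rB] [sL sB].
split=> [a b ga gb k|a b ga gb]; apply/lfunP => -[u v].
  rewrite /dsum_act add_lfunE scale_lfunE !lfunE /= /dsum_fun /=.
  by rewrite rL // sL // !add_lfunE !scale_lfunE.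
rewrite {2}/lie_bracket /dsum_act add_lfunE opp_lfunE !comp_lfunE.
rewrite !lfunE /= /dsum_fun /= rB // sB //.
by rewrite /lie_bracket !add_lfunE !opp_lfunE !comp_lfunE.
Qed.

Lemma dual_act_is_rep : is_rep g (dual_act rho).
Proof.
case: rhoP => [rL rB].
split=> [a b ga gb k|a b ga gb]; apply/lfunP => l; apply/lfunP => v.
  rewrite /dual_act add_lfunE scale_lfunE !lfunE /= /dual_fun.
  rewrite !(add_lfunE, opp_lfunE, scale_lfunE, comp_lfunE) rL //.
  by rewrite !(add_lfunE, scale_lfunE) linearP /= opprD scalerN.
rewrite {2}/lie_bracket /dual_act add_lfunE opp_lfunE !comp_lfunE.
rewrite !lfunE /= /dual_fun rB // /lie_bracket.
rewrite !(add_lfunE, opp_lfunE, comp_lfunE) linearB /=.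
by rewrite !opprK opprB.
Qed.

Lemma tensor_act_is_rep : is_rep g (tensor_act rho sigma).
Proof.
case: rhoP sigmaP => [rL rB] [sL sB].
have ext (f h : 'End(tensor V W)) :
    (forall v w, f (tmul v w) = h (tmul v w)) -> f = h.
  move=> fh; apply/lfunP => T; rewrite (tensor_sum T) !linear_sum.
  by apply: eq_bigr => i _; apply: fh.
have tDl (u v : V) (w : W) : tmul (u + v) w = tmul u w + tmul v w.
  by apply/lfunP => l; rewrite add_lfunE !tmulE scalerDr.
have tDr (v : V) (u w : W) : tmul v (u + w) = tmul v u + tmul v w.
  by apply/lfunP => l; rewrite add_lfunE !tmulE linearD scalerDl.
have tZl k (v : V) (w : W) : tmul (k *: v) w = k *: tmul v w.
  by apply/lfunP => l; rewrite scale_lfunE !tmulE !scalerA mulrC.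
have tZr k (v : V) (w : W) : tmul v (k *: w) = k *: tmul v w.
  by apply/lfunP => l; rewrite scale_lfunE !tmulE linearZ /= scalerA.
split=> [a b ga gb k|a b ga gb]; apply: ext => v w.
  rewrite add_lfunE scale_lfunE !tensor_act_tmul rL // sL //.
  rewrite !(add_lfunE, scale_lfunE) tDl tDr tZl tZr scalerDr.
  by rewrite addrACA.
rewrite {2}/lie_bracket add_lfunE opp_lfunE !comp_lfunE !tensor_act_tmul.
rewrite !linearD /= !tensor_act_tmul rB // sB // /lie_bracket.
rewrite !add_lfunE !opp_lfunE !comp_lfunE -!scaleN1r tDl tDr tZl tZr !scaleN1r.
set t1 := tmul (rho a (rho b v)) w; set t2 := tmul (rho b (rho a v)) w.
set t3 := tmul v (sigma a (sigma b w)); set t4 := tmul v (sigma b (sigma a w)).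
set t5 := tmul (rho b v) (sigma a w); set t6 := tmul (rho a v) (sigma b w).
rewrite [t1 + t5 + _](AC (2*2) ((1*4)*(2*3))) /= !opprD.
rewrite [- t2 - t6 + _](AC (2*2) ((1*4)*(3*2))) /= -[- t5 - t6]opprD.
by rewrite [RHS]addrACA subrr addr0 addrACA.
Qed.

End IsRep.

End Representations.

Lemma stationary (T : eqType) (Phi : T -> T) (U : nat -> T) (m : T -> nat) d :
    (forall n, U n.+1 = Phi (U n)) -> (forall n, (m (U n) <= d)%N) ->
    (forall n, U n != U n.+1 -> (m (U n) < m (U n.+1))%N) ->
  forall n, exists2 k : 'I_d.+1, true & U n = U k.
Proof.
move=> US mU mS n.
have [k kE] : exists k : 'I_d.+1, U k == U k.+1.
  apply/existsP; apply: contraT; rewrite negb_exists => /forallP Une.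
  suff mj j : (j <= d.+1)%N -> (j <= m (U j))%N.
    by have := mj _ (leqnn d.+1); rewrite ltnNge mU.
  elim: j => // j IHj jd.
  exact: leq_ltn_trans (IHj (ltnW jd)) (mS _ (Une (Ordinal jd))).
have [nd|dn] := ltnP n d.+1; first by exists (Ordinal nd).
exists k => //; have kn : (k <= n)%N by rewrite (leq_trans (ltnW (ltn_ord k))).
rewrite -(subnKC kn); elim: (n - k)%N => [|j IHj]; first by rewrite addn0.
by rewrite addnS US IHj -US -(eqP kE).
Qed.

Section Filtrations.
Variables (K : fieldType) (E : vectType K) (V W : 'I_2 -> {vspace E}).

Fixpoint Fstage (s : 'S_2) (n : nat) : {vspace E} :=
  if n is m.+1 then
    \sum_(i < 2) ((Fstage s m + V i) :&: (Fstage s m + W (s i)))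
  else 0%VS.

(* The stages increase and are stationary from n = \dim E on, so this finite sum
   is the sum over all n, see Fstage_sub. *)
Definition Fsum (s : 'S_2) : {vspace E} :=
  (\sum_(n < (\dim {:E}).+1) Fstage s n)%VS.

Fixpoint Ftilde_stage (n : nat) : {vspace E} :=
  if n is m.+1 then
    \bigcap_(i < 2) \bigcap_(j < 2)
      ((Ftilde_stage m :&: V i) + (Ftilde_stage m :&: W j))
  else fullv.

(* Likewise, this is the intersection of all stages, see Ftilde_sub_stage. *)
Definition Ftilde : {vspace E} :=
  (\bigcap_(n < (\dim {:E}).+1) Ftilde_stage n)%VS.

Lemma Fstage_sub s n : (Fstage s n <= Fsum s)%VS.
Proof.
have [//|k|k|k _ ->] := @stationary _
  (fun F => \sum_(i < 2) ((F + V i) :&: (F + W (s i))))%VS (Fstage s)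
  (fun U => \dim U) (\dim {:E}) _ _ _ n.
- exact/dimvS/subvf.
- have FS : (Fstage s k <= Fstage s k.+1)%VS.
    by rewrite /= (subv_trans _ (sumv_sup ord0 _ (subvv _))) // subv_cap !addvSl.
  by rewrite ltnNge; apply: contra => kS; rewrite eqEdim FS.
- exact: (sumv_sup k).
Qed.

Lemma Fsum_sub s (U : {vspace E}) :
  (forall n, (Fstage s n <= U)%VS) -> (Fsum s <= U)%VS.
Proof. by move=> FU; apply/subv_sumP. Qed.

Lemma Ftilde_sub_stage n : (Ftilde <= Ftilde_stage n)%VS.
Proof.
have [//|k|k|k _ ->] := @stationary _
  (fun F => \bigcap_(i < 2) \bigcap_(j < 2) ((F :&: V i) + (F :&: W j)))%VS
  Ftilde_stage (fun U => \dim {:E} - \dim U)%N (\dim {:E}) _ _ _ n.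
- exact: leq_subr.
- have FS : (Ftilde_stage k.+1 <= Ftilde_stage k)%VS.
    rewrite /= (subv_trans (bigcapv_inf ord0 _ (subvv _))) //.
    by rewrite (subv_trans (bigcapv_inf ord0 _ (subvv _))) // subv_add !capvSl.
  move=> kS; apply: ltn_sub2l.
    rewrite (leq_trans _ (dimvS (subvf (Ftilde_stage k)))) //.
    by rewrite ltnNge; apply: contra kS => kS; rewrite eq_sym eqEdim FS.
  by rewrite ltnNge; apply: contra kS => kS; rewrite eq_sym eqEdim FS.
- exact: (bigcapv_inf k).
Qed.

Lemma sub_Ftilde (U : {vspace E}) :
  (forall n, (U <= Ftilde_stage n)%VS) -> (U <= Ftilde)%VS.
Proof. by move=> FU; apply/subv_bigcapP. Qed.

End Filtrations.

(* Main.v *)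
From HB Require Import structures.
Require Import Defs.
From mathcomp Require Import all_boot all_order all_fingroup all_algebra.
From mathcomp Require Import ring.
Import GRing.Theory.
Local Open Scope ring_scope.
Set Implicit Arguments.
Unset Strict Implicit.
Unset Printing Implicit Defensive.

(** Let p be the projector onto V 0 along V 1 and q the projector onto W 0
    along W 1.  Put d = p - q and c = p + q - 1.  Any two idempotents satisfy
    c^2 + d^2 = 1 and c d = - d c, and everything follows from these two
    relations.  The recursions defining the three subspaces read

      Fstage 1 n = ker d^n,  Fstage tau n = ker c^n,
      Ftilde_stage n = im (c d)^n

    ([Fstage_kerX], [Ftilde_stage_imX]), so Fe and Ft are the generalised
    kernels of d and c, and Fn is the part on which both are invertible.

    Since W i is the orthogonal of V i, the adjoint of p is 1 - q; hence d is
    self-adjoint and c is skew-adjoint, and both commute with g.  Two remarks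
    about an endomorphism h that is stable and injective, hence bijective, on a
    subspace A then do all the work: vectors sent into A by a power of h lie in
    A plus the generalised kernel of h ([stable_inj_split]), and A is orthogonal
    to the generalised kernel of the adjoint of h ([orthov_kerX]).

    (i) c d is bijective on Fn, and d is bijective on the generalised kernel
    of c because d^2 = 1 - c^2.  Splitting off the two kernels in turn fills E,
    and the pieces are orthogonal.

    (ii) On Fe the endomorphism c^2 = 1 - d^2 is unipotent, so Fe is the sum of
    the generalised eigenspaces of c for 1 and -1.  As c is skew-adjoint both
    are totally isotropic, and the form identifies the second with the dual of
    the first ([hyperbolic_rep]).

    (iii) Likewise Ft is the sum of the generalised eigenspaces of d for 1 and
    -1, which are orthogonal to each other because d is self-adjoint.

    (iv) Fn is the sum of its intersections with V 0 and V 1, which c d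
    exchanges bijectively; so Fn is twice Fn :&: V 0 ([double_rep]).  That
    subspace is non-degenerate, since Fn :&: W 0 is orthogonal to it and
    Fn = Fn :&: V 0 + Fn :&: W 0. *)

(** * Iterates of an endomorphism *)

Lemma coordwise (K : fieldType) (E : vectType K) (x y : E) :
  (forall i, coord (vbasis {:E}) i x = coord (vbasis {:E}) i y) -> x = y.
Proof.
move=> xy; rewrite (coord_vbasis (memvf x)) (coord_vbasis (memvf y)).
by apply: eq_bigr => i _; rewrite xy.
Qed.

(* Decides additive identities between vectors, by reading them on coordinates
   where they become ring identities. *)
Ltac vector_ring :=
  apply: coordwise => ?; rewrite ?(linearD, linearN, linearZ, linear0) /=; ring.

Section Iterates.
Variables (K : fieldType) (E : vectType K).
Implicit Types (f h : 'End(E)) (A B : {vspace E}) (n : nat) (x : E).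

Lemma id_addE f x : (\1 + f)%VF x = x + f x.
Proof. by rewrite add_lfunE id_lfunE. Qed.

Lemma id_subE f x : (\1 - f)%VF x = x - f x.
Proof. by rewrite add_lfunE opp_lfunE id_lfunE. Qed.

Lemma iterB f n x y : iter n f (x - y) = iter n f x - iter n f y.
Proof. by elim: n => //= n ->; rewrite linearB. Qed.

Lemma iter_linear0 f n : iter n f 0 = 0.
Proof. by elim: n => //= n ->; rewrite linear0. Qed.

Lemma iterZ f n k x : iter n f (k *: x) = k *: iter n f x.
Proof. by elim: n => //= n ->; rewrite linearZ. Qed.

Lemma iter_eigen f n k x : f x = k *: x -> iter n f x = k ^+ n *: x.
Proof.
move=> fx; elim: n => [|n IHn]; first by rewrite expr0 scale1r.
by rewrite iterSr fx iterZ IHn scalerA exprS.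
Qed.

(** The cases s = 1 and s = -1 serve for commuting and for anticommuting
    endomorphisms. *)
Lemma iter_skew s f h m n x :
    (forall x, f (h x) = s *: h (f x)) ->
  iter m f (iter n h x) = s ^+ (m * n) *: iter n h (iter m f x).
Proof.
move=> fh; have fhn y : f (iter n h y) = s ^+ n *: iter n h (f y).
  elim: n => [|n IHn]; first by rewrite expr0 scale1r.
  by rewrite iterS fh IHn linearZ /= scalerA exprS.
elim: m => [|m IHm]; first by rewrite mul0n expr0 scale1r.
by rewrite iterS IHm linearZ /= fhn scalerA mulSn addnC exprD.
Qed.

Lemma iter_skew_comp s f h n x :
    (forall x, f (h x) = s *: h (f x)) ->
  exists k, iter n f (iter n h x) = s ^+ k *: iter n (f \o h)%VF x.
Proof.
move=> fh; elim: n => [|n [k IHn]]; first by exists 0%N; rewrite expr0 scale1r.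
exists (n + k)%N; rewrite [iter n.+1 h x]iterS iterS.
have /= -> := @iter_skew s f h n 1 (iter n h x) fh.
by rewrite muln1 IHn !linearZ /= comp_lfunE scalerA exprD.
Qed.

(** The kernel of f^n.  Written as an iterated preimage it follows the same
    recursion as the stages of the filtrations. *)
Definition kerX f n : {vspace E} := iter n (lfun_preim f) 0%VS.

Lemma mem_kerX f n x : (x \in kerX f n) = (iter n f x == 0).
Proof.
elim: n x => [|n IHn] x; first by rewrite memv0.
by rewrite iterSr -IHn memv_preim.
Qed.

Lemma kerXP f n x : reflect (iter n f x = 0) (x \in kerX f n).
Proof. by rewrite mem_kerX; apply: eqP. Qed.

Lemma kerX_leq f m n : (m <= n)%N -> (kerX f m <= kerX f n)%VS.
Proof.
move=> mn; apply/subvP => x /kerXP fx; apply/kerXP.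
by rewrite -(subnK mn) iterD fx; elim: (n - m)%N => //= k ->; rewrite linear0.
Qed.

Lemma kerX_stable s f h n x : (forall x, f (h x) = s *: h (f x)) ->
  x \in kerX f n -> h x \in kerX f n.
Proof.
move=> fh /kerXP fx; apply/kerXP.
by have /= -> := @iter_skew s f h n 1 x fh; rewrite fx linear0 scaler0.
Qed.

Definition imX f n : {vspace E} := iter n (lfun_img f) fullv.

Lemma imXP f n x : reflect (exists y, x = iter n f y) (x \in imX f n).
Proof.
apply: (iffP idP) => [|[y ->]]; last first.
  by elim: n => [|n IHn]; rewrite ?memvf // memv_img.
elim: n x => [|n IHn] x; first by exists x.
by case/memv_imgP => y /IHn[z ->] ->; exists z.
Qed.

Lemma imX_stable s f h n x : (forall x, f (h x) = s *: h (f x)) -> s != 0 ->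
  x \in imX f n -> h x \in imX f n.
Proof.
move=> fh s0 /imXP[y ->]; apply/imXP; exists ((s ^+ n)^-1 *: h y).
have /= fhn := @iter_skew s f h n 1 y fh.
by rewrite iterZ fhn muln1 scalerA mulVf ?scale1r // expf_neq0.
Qed.

(** In finite dimension this says that h restricts to a bijection of A. *)
Definition stable_inj h A :=
  {in A, forall x, h x \in A} /\ {in A, forall x, h x = 0 -> x = 0}.

Lemma stable_inj_img h A : stable_inj h A -> (h @: A)%VS = A.
Proof.
case=> hA hI; apply/eqP; rewrite eqEdim; apply/andP; split.
  by apply/subvP => _ /memv_imgP[x Ax ->]; apply: hA.
rewrite limg_dim_eq //; apply/eqP; rewrite -subv0; apply/subvP => x.
by rewrite memv_cap memv_ker memv0 => /andP[Ax /eqP/(hI x Ax)/eqP].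
Qed.

Lemma stable_inj_onto h A n y : stable_inj h A -> y \in A ->
  exists2 z, z \in A & iter n h z = y.
Proof.
move=> hA; elim: n y => [|n IHn] y Ay; first by exists y.
move: Ay; rewrite -{1}(stable_inj_img hA) => /memv_imgP[z /IHn[w Aw <-] ->].
by exists w.
Qed.

(** A preimage z in A of h^n x exists because h is onto on A, and x - z is
    killed by h^n. *)
Lemma stable_inj_split h A n x : stable_inj h A -> iter n h x \in A ->
  x \in (A + kerX h n)%VS.
Proof.
move=> hA /(stable_inj_onto n hA)[z Az zx]; rewrite -[x](subrKC z).
by rewrite memv_add //; apply/kerXP; rewrite iterB zx subrr.
Qed.

Lemma stable_inj_disjoint h A n : stable_inj h A -> (A :&: kerX h n = 0)%VS.
Proof.
case=> hA hI; apply/eqP; rewrite -subv0; apply/subvP => x.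
rewrite memv_cap memv0 => /andP[Ax /kerXP]; elim: n x Ax => [|n IHn] x Ax.
  by move/eqP.
by rewrite iterSr => /(IHn _ (hA x Ax))/eqP/(hI x Ax)/eqP.
Qed.

(** On the generalised kernel of f the endomorphism h is k minus a nilpotent
    one. *)
Lemma shift_stable_inj f h k n : k != 0 -> (forall x, h x = k *: x - f x) ->
  stable_inj h (kerX f n).
Proof.
move=> k0 hE; split=> x fx.
  apply: (kerX_stable (s := 1)) fx => y.
  by rewrite scale1r !hE linearB linearZ.
rewrite hE => /subr0_eq/esym fxk; move/kerXP: fx; rewrite (iter_eigen _ fxk).
by move/eqP; rewrite scaler_eq0 expf_eq0 (negPf k0) andbF => /eqP.
Qed.

End Iterates.

(** * Pairs of endomorphisms with c^2 + d^2 = 1 *)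

Section CirclePair.
Variables (K : fieldType) (E : vectType K) (c d : 'End(E)) (N : nat).
Hypothesis circle : forall x, c (c x) + d (d x) = x.

(** A vector killed by c is fixed by d^2, so it vanishes if d is nilpotent
    on it. *)
Lemma circle_stable_inj n :
  (forall x, d (c x) = - c (d x)) -> stable_inj c (kerX d n).
Proof.
move=> dc; split=> x xd.
  by apply: (kerX_stable (s := -1)) xd => y; rewrite scaleN1r.
move=> cx; have ddx : (d \o d)%VF x = 1 *: x.
  by rewrite scale1r comp_lfunE -[RHS]circle cx linear0 add0r.
have [y|k] := @iter_skew_comp _ _ 1 d d n x; first by rewrite scale1r.
rewrite (iter_eigen _ ddx) !expr1n !scale1r => <-.
by rewrite -iterD; apply/kerXP/(subvP (kerX_leq _ (leq_addr n n))).
Qed.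

Hypothesis kerd : forall n, (kerX d n <= kerX d N)%VS.
Hypothesis two : 2%:R != 0 :> K.

Lemma one_pm_stable_inj n : stable_inj (\1 + c)%VF (kerX (\1 - c)%VF n) /\
  stable_inj (\1 - c)%VF (kerX (\1 + c)%VF n).
Proof.
by split; apply: (shift_stable_inj _ two) => x;
  rewrite id_subE id_addE; vector_ring.
Qed.

(** (1 - c) (1 + c) = d^2, and 1 + c is invertible on the generalised kernel
    of 1 - c because 2 is.  The hypothesis on N absorbs the doubling of the
    exponent. *)
Lemma kerX_circle_split :
  (kerX (\1%VF - c)%R N + kerX (\1%VF + c)%R N)%VS = kerX d N.
Proof.
pose f := (\1 - c)%VF; pose h := (\1 + c)%VF.
have fh x : f (h x) = d (d x).
  rewrite !(id_subE, id_addE) -[d (d x)](addKr (c (c x))) circle.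
  by rewrite linearD /=; vector_ring.
have hf x : h (f x) = d (d x).
  rewrite !(id_subE, id_addE) -[d (d x)](addKr (c (c x))) circle.
  by rewrite linearB /=; vector_ring.
have fhC x : f (h x) = 1 *: h (f x) by rewrite scale1r fh hf.
have fhd n x : iter n f (iter n h x) = iter (n + n) d x.
  have [k ->] := iter_skew_comp n x fhC.
  have [y|l] := @iter_skew_comp _ _ 1 d d n x; first by rewrite scale1r.
  rewrite iterD !expr1n !scale1r => ->; apply: eq_iter => y.
  by rewrite !comp_lfunE fh.
apply/eqP; rewrite eqEsubv subv_add -andbA; apply/and3P; split.
- apply/subvP => x /kerXP fx; apply/(subvP (kerd (N + N)))/kerXP.
  by rewrite -fhd (iter_skew _ _ _ fhC) fx expr1n scale1r -/h iter_linear0.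
- apply/subvP => x /kerXP hx; apply/(subvP (kerd (N + N)))/kerXP.
  by rewrite -fhd hx iter_linear0.
- apply/subvP => x /kerXP dx; apply: stable_inj_split.
    by case: (one_pm_stable_inj N).
  by apply/kerXP; rewrite fhd iterD dx iter_linear0.
Qed.

End CirclePair.

(** * Orthogonality and the pairing defined by a form *)

Section Dimensions.
Variables (K : fieldType) (V W : vectType K).

Lemma dim_prodv : \dim {:(V * W)%type} = (\dim {:V} + \dim {:W})%N.
Proof. by rewrite !dimvf. Qed.

Lemma dim_homv : \dim {:'Hom(V, W)} = (\dim {:V} * \dim {:W})%N.
Proof. by rewrite !dimvf. Qed.

Lemma dim_dual : \dim {:dual V} = \dim {:V}.
Proof. by rewrite !dimvf; apply: muln1. Qed.

Lemma dim_subvs (U : {vspace V}) : \dim {:subvs_of U} = \dim U.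
Proof. by rewrite dimvf. Qed.

End Dimensions.

Section Form.
Variables (K : fieldType) (E : vectType K) (eps : bool).
Variable form : {hermitian E for eps & idfun}.
Implicit Types (A B F : {vspace E}) (x y : E).

Definition pair_fun A y : subvs_of A -> K^o := fun u => form (vsval u) y.
Fact pair_fun_linear A y : linear (@pair_fun A y).
Proof. by move=> k u v; rewrite /pair_fun linearP /= linearPl. Qed.
HB.instance Definition _ A y :=
  GRing.isLinear.Build K (subvs_of A) K^o _ (@pair_fun A y) (pair_fun_linear y).

Definition pairing_fun A y : dual (subvs_of A) := linfun (@pair_fun A y).
Fact pairing_fun_linear A : linear (@pairing_fun A).
Proof.
move=> k u v; apply/lfunP => x.
by rewrite add_lfunE scale_lfunE !lfunE /= /pair_fun linearPr.
Qed.
HB.instance Definition _ A :=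
  GRing.isLinear.Build K E (dual (subvs_of A)) _ (@pairing_fun A)
    (@pairing_fun_linear A).

(** The map E -> A^* sending y to the restriction of form _ y to A. *)
Definition pairing A : 'Hom(E, dual (subvs_of A)) := linfun (@pairing_fun A).

Lemma pairingE A y (u : subvs_of A) : pairing A y u = form (vsval u) y.
Proof. by rewrite !lfunE. Qed.

Lemma form_swap0 x y : form x y = 0 -> form y x = 0.
Proof. by move=> /eqP; rewrite herm_eq0C => /eqP. Qed.

Lemma lker_pairing A : lker (pairing A) = orthov form A.
Proof.
apply/vspaceP => y; apply/idP/mem_orthovP => [|yA].
  rewrite memv_ker => /eqP yA x Ax; apply: form_swap0.
  by rewrite -[x]/(vsval (Subvs Ax)) -pairingE yA lfunE.
rewrite memv_ker; apply/eqP/lfunP => x; rewrite pairingE lfunE.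
exact/form_swap0/yA/subvsP.
Qed.

(** The orthogonal of A is the kernel of a map into the dual of A. *)
Lemma dim_orthov_geq A : (\dim {:E} <= \dim A + \dim (orthov form A))%N.
Proof.
rewrite -(limg_ker_dim (pairing A) fullv) capfv lker_pairing addnC leq_add2r.
by rewrite (leq_trans (dimvS (subvf _))) // dim_dual dim_subvs.
Qed.

(** The pairing embeds B into the dual of A. *)
Lemma dim_separated A B : (B :&: orthov form A = 0)%VS -> (\dim B <= \dim A)%N.
Proof.
rewrite -lker_pairing => /limg_dim_eq <-.
by rewrite (leq_trans (dimvS (subvf _))) // dim_dual dim_subvs.
Qed.

(** A vector of A orthogonal to A is orthogonal to A + B = E. *)
Lemma orthov_summand A B : nondegenerate form -> (A + B)%VS = fullv ->
  (A <= orthov form B)%VS -> (A :&: orthov form A = 0)%VS.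
Proof.
move=> /eqP nd AB /orthovP oAB; apply/eqP; rewrite -subv0 -nd -AB.
apply/subvP => x; rewrite memv_cap => /andP[Ax /mem_orthovP oxA].
apply/mem_orthovP => _ /memv_addP[a Aa [b Bb ->]].
by rewrite linearDr /= oxA // oAB // addr0.
Qed.

(** The two orthogonals meet in the radical, and each has at least the
    complementary dimension, so they must fill E. *)
Lemma orthov_complement (A B : {vspace E}) : nondegenerate form ->
    (A :&: B = 0)%VS -> (A + B)%VS = fullv ->
  (orthov form A :&: orthov form B = 0)%VS /\
  (orthov form A + orthov form B)%VS = fullv.
Proof.
move=> /eqP nd AB0 ABf.
have W0 : (orthov form A :&: orthov form B = 0)%VS.
  apply/eqP; rewrite -subv0 -nd -ABf orthovD.
  by rewrite capvSl capvSr.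
split=> //; apply/eqP; rewrite eqEdim subvf dimv_disjoint_sum //=.
have := leq_add (dim_orthov_geq A) (dim_orthov_geq B).
by rewrite addnACA -(dimv_disjoint_sum AB0) ABf leq_add2l.
Qed.

(** For a non-degenerate form, mutually orthogonal subspaces that fill E are
    automatically independent. *)
Lemma direct_sum3_orthov A B C :
    nondegenerate form -> (A + B + C)%VS = fullv ->
    (A <= orthov form B)%VS -> (A <= orthov form C)%VS ->
    (B <= orthov form C)%VS ->
  direct_sum3 fullv A B C.
Proof.
move=> nd ABC AB AC BC; split=> //.
have cap0 X Y : (X <= orthov form Y)%VS -> (Y :&: orthov form Y = 0)%VS ->
    (X :&: Y = 0)%VS.
  move=> XY Y0; apply/eqP; rewrite -subv0 -Y0 capvC.
  exact: capvS.
have AB0 : (A :&: B = 0)%VS.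
  apply: cap0 => //; apply: (orthov_summand nd (B := (A + C)%VS)).
    by rewrite -ABC addvA [(B + A)%VS]addvC.
  by rewrite orthovD BC orthov_sym AB.
have ABC0 : ((A + B) :&: C = 0)%VS.
  apply: cap0; first by rewrite orthoDv AC.
  apply: (orthov_summand nd (B := (A + B)%VS)); first by rewrite addvC.
  by rewrite orthov_sym orthoDv AC.
by rewrite !directv_addE /= !directv_trivial AB0 ABC0 !eqxx.
Qed.

(** Every y in A is f'^n z for some z in A, so form x y = form (f^n x) z = 0
    when f^n x = 0. *)
Lemma orthov_kerX (f f' : 'End(E)) A n :
    (forall x y, form (f x) y = form x (f' y)) ->
  stable_inj f' A -> (kerX f n <= orthov form A)%VS.
Proof.
move=> adj f'A; apply/orthovP => x y /kerXP fx /(stable_inj_onto n f'A)[z _ <-].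
suff adjn m u v : form (iter m f u) v = form u (iter m f' v).
  by rewrite -adjn fx linear0l.
by elim: m u => // m IHm u; rewrite iterSr IHm adj -iterS.
Qed.

End Form.

(** * Representations *)

Section Reps.
Variables (K : fieldType) (E : vectType K) (g : {vspace 'End(E)}).

Lemma subrepP (U : {vspace E}) :
  subrep g U <-> {in g, forall a : 'End(E), {in U, forall x, a x \in U}}.
Proof.
split=> gU a ga; first by move=> x Ux; rewrite (subvP (gU a ga)) // memv_img.
by apply/subvP => _ /memv_imgP[x Ux ->]; apply: gU.
Qed.

Lemma subrep_orthov (eps : bool) (form : {hermitian E for eps & idfun}) A :
    {in g, forall (a : 'End(E)) x y, form (a x) y + form x (a y) = 0} ->
  subrep g A -> subrep g (orthov form A).
Proof.
move=> g_form /subrepP gA; apply/subrepP => a ga x /mem_orthovP oxA.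
apply/mem_orthovP => y Ay.
by have := g_form a ga x y; rewrite (oxA (a y)) ?gA // addr0.
Qed.

Definition commutant (f : 'End(E)) : Prop :=
  forall a x, a \in g -> f (a x) = a (f x).

Lemma commutantD f h : commutant f -> commutant h -> commutant (f + h).
Proof.
move=> fg hg a x ga.
by rewrite !add_lfunE (fg a x) // (hg a x) // linearD.
Qed.

Lemma commutantN f : commutant f -> commutant (- f).
Proof. by move=> fg a x ga; rewrite !opp_lfunE (fg a x) // linearN. Qed.

Lemma commutant1 : commutant \1%VF.
Proof. by move=> a x ga; rewrite !id_lfunE. Qed.

Lemma commutantM f h : commutant f -> commutant h -> commutant (f \o h)%VF.
Proof. by move=> fg hg a x ga; rewrite !comp_lfunE (hg a x) // (fg a). Qed.

Lemma subrep_kerX f n : commutant f -> subrep g (kerX f n).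
Proof.
move=> fg; apply/subrepP => a ga x fx; apply: (kerX_stable (s := 1)) fx => y.
by rewrite scale1r fg.
Qed.

Lemma subrep_imX f n : commutant f -> subrep g (imX f n).
Proof.
move=> fg; apply/subrepP => a ga x fx.
apply: (imX_stable (s := 1)) fx => [y|]; last exact: oner_neq0.
by rewrite scale1r fg.
Qed.

Lemma subrep_cap A B : subrep g A -> subrep g B -> subrep g (A :&: B)%VS.
Proof.
move=> /subrepP gA /subrepP gB; apply/subrepP => a ga x.
by rewrite !memv_cap => /andP[Ax Bx]; rewrite gA ?gB.
Qed.

Lemma dsum_actE (V W : vectType K) (rho : 'End(E) -> 'End(V))
    (sigma : 'End(E) -> 'End(W)) a p :
  dsum_act rho sigma a p = (rho a p.1, sigma a p.2).
Proof. by rewrite lfunE. Qed.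

Lemma dual_actE (V : vectType K) (rho : 'End(E) -> 'End(V)) a (l : dual V) v :
  dual_act rho a l v = - l (rho a v) :> K^o.
Proof. by rewrite lfunE /= opp_lfunE comp_lfunE. Qed.

(** An equivariant embedding into a space that is not larger is an
    isomorphism, and so is its inverse. *)
Lemma lker0_rep_iso (V W : vectType K) (rho : 'End(E) -> 'End(V)) sigma
    (f : 'Hom(V, W)) :
    lker f == 0%VS -> (\dim {:W} <= \dim {:V})%N ->
    {in g, forall a, (f \o rho a)%VF = (sigma a \o f)%VF} ->
  rep_iso g rho sigma f /\ rep_iso g sigma rho f^-1%VF.
Proof.
move=> f0 dimWV fg; have fK := lker0_lfunK f0.
have fVK : cancel f^-1%VF f.
  move=> w; apply: limg_lfunVK; suff -> : limg f = fullv by apply: memvf.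
  apply/eqP; rewrite eqEdim subvf limg_dim_eq //.
  by rewrite (eqP f0) capv0.
split; split=> //; first by exists f^-1%VF.
  by exists f.
move=> a ga; apply/lfunP => w; rewrite !comp_lfunE -[in LHS](fVK w).
have /lfunP/(_ (f^-1%VF w)) := fg a ga; rewrite !comp_lfunE => <-.
by rewrite fK.
Qed.

Lemma daddv_pi_eq0 (A B : {vspace E}) x :
  (A :&: B = 0)%VS -> x \in B -> daddv_pi A B x = 0.
Proof.
move=> AB Bx; have := daddv_pi_add AB (subvP (addvSr A B) x Bx).
rewrite (daddv_pi_id (U := B)) ?[(B :&: A)%VS]capvC //.
by move/(canRL (addrK _)); rewrite subrr.
Qed.

Lemma daddv_pi_comm (A B : {vspace E}) (a : 'End(E)) x :
    subrep g A -> subrep g B -> a \in g -> (A :&: B = 0)%VS ->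
    x \in (A + B)%VS ->
  daddv_pi A B (a x) = a (daddv_pi A B x).
Proof.
move=> /subrepP gA /subrepP gB ga AB /memv_addP[u Au [v Bv ->]].
rewrite !linearD /= (daddv_pi_id AB Au) (daddv_pi_id AB (gA a ga u Au)).
by rewrite (daddv_pi_eq0 AB Bv) (daddv_pi_eq0 AB (gB a ga v Bv)) linear0.
Qed.

(** The inverse isomorphism F -> A * A^* sends x to its component in A along B
    and to the functional form _ x on A.  It is injective because a vector of B
    orthogonal to A is orthogonal to A + B = F; the same argument, with A and B
    exchanged as well, gives \dim A = \dim B. *)
Lemma hyperbolic_rep (eps : bool) (form : {hermitian E for eps & idfun})
    (F A B : {vspace E}) :
    {in g, forall (a : 'End(E)) x y, form (a x) y + form x (a y) = 0} ->
    subrep g A -> subrep g B -> (A + B)%VS = F -> (A :&: B = 0)%VS ->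
    (A <= orthov form A)%VS -> (B <= orthov form B)%VS ->
    (F :&: orthov form F = 0)%VS ->
  exists2 phi : 'Hom((subvs_of A * dual (subvs_of A))%type, subvs_of F),
    rep_iso g (dsum_act (sub_act A) (dual_act (sub_act A))) (sub_act F) phi
    & forall u : subvs_of A, vsval (phi (u, 0)) = vsval u.
Proof.
move=> g_form gA gB ABF AB0 isoA isoB ndF.
have gF : subrep g F.
  move=> a ga; rewrite -ABF limgD addvS //; [exact: gA | exact: gB].
have sep C D : (C + D)%VS = F -> (D <= orthov form D)%VS ->
    (D :&: orthov form C = 0)%VS.
  move=> CD isoD; apply/eqP; rewrite -subv0 -ndF subv_cap -CD.
  rewrite (subv_trans (capvSl _ _) (addvSr C D)) orthovD capvSr.
  exact: subv_trans (capvSl _ _) isoD.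
have dAB : \dim A = \dim B.
  by apply/eqP; rewrite eqn_leq !(@dim_separated _ _ _ form) ?sep // addvC.
pose pi := daddv_pi A B.
have FP (x : subvs_of F) : vsval x \in (A + B)%VS by rewrite ABF subvsP.
pose th_fun (x : subvs_of F) :=
  (vsproj A (pi (vsval x)), pairing form A (vsval x)).
have th_lin : linear th_fun by move=> k x y; rewrite /th_fun !linearP.
pose thL := GRing.isLinear.Build K (subvs_of F)
  (subvs_of A * dual (subvs_of A))%type _ th_fun th_lin.
pose th1 : {linear subvs_of F -> (subvs_of A * dual (subvs_of A))%type} :=
  HB.pack th_fun thL.
pose th := linfun th1; have thE x : th x = th_fun x by rewrite lfunE.
have th0 : lker th == 0%VS.
  rewrite -subv0; apply/subvP => x; rewrite memv_ker thE memv0 => /eqP[].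
  move/(congr1 vsval); rewrite vsprojK ?memv_pi //= => pix0 px0.
  have xB : vsval x \in B.
    by rewrite -(daddv_pi_add AB0 (FP x)) -/pi pix0 add0r memv_pi.
  have : vsval x \in (B :&: orthov form A)%VS.
    by rewrite memv_cap xB -lker_pairing memv_ker px0 eqxx.
  by rewrite sep // memv0.
have [||_ iso] := @lker0_rep_iso _ _ (sub_act F)
  (dsum_act (sub_act A) (dual_act (sub_act A))) th th0.
- by rewrite dim_prodv dim_dual !dim_subvs -ABF dimv_disjoint_sum // -dAB.
- move=> a ga; apply/lfunP => x; rewrite !comp_lfunE !thE.
  rewrite dsum_actE /th_fun /= (sub_actE _ gF ga).
  congr (_, _).
    apply: val_inj; rewrite /= (sub_actE _ gA ga) !vsprojK ?memv_pi //.
    exact: daddv_pi_comm.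
  apply/lfunP => y; rewrite dual_actE !pairingE (sub_actE _ gA ga).
  by apply/eqP; rewrite -addr_eq0 addrC g_form.
exists th^-1%VF => // u.
have uF : vsval u \in F by rewrite -ABF (subvP (addvSl A B)) ?subvsP.
suff -> : (u, 0) = th (Subvs uF) by rewrite lker0_lfunK.
rewrite thE /th_fun /= /pi (daddv_pi_id AB0) ?subvsP // vsvalK.
congr (_, _); apply/esym/eqP; rewrite -memv_ker lker_pairing.
exact: subvP isoA _ (subvsP u).
Qed.

(** Since j identifies B with A, a vector x = a + b with a in A and b in B is
    sent to a (x) e_0 + j b (x) e_1. *)
Lemma double_rep (F A B : {vspace E}) (j : 'End(E)) :
    subrep g A -> subrep g B -> (A + B)%VS = F -> (A :&: B = 0)%VS ->
    (forall a x, a \in g -> j (a x) = a (j x)) ->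
    {in A, forall x, j x \in B} -> {in B, forall x, j x \in A} ->
    {in F, forall x, j x = 0 -> x = 0} ->
  exists phi : 'Hom(subvs_of F, tensor (subvs_of A) 'rV[K]_2),
    rep_iso g (sub_act F)
      (tensor_act (sub_act A) (@triv_act K E 'rV[K]_2)) phi.
Proof.
move=> gA gB ABF AB0 gj jAB jBA j0.
have gF : subrep g F.
  move=> a ga; rewrite -ABF limgD addvS //; [exact: gA | exact: gB].
have AF : (A <= F)%VS by rewrite -ABF addvSl.
have BF : (B <= F)%VS by rewrite -ABF addvSr.
have BA0 : (B :&: A = 0)%VS by rewrite capvC.
pose al := daddv_pi A B; pose be := daddv_pi B A.
pose e i : 'rV[K]_2 := delta_mx 0 i.
have FP (x : subvs_of F) : vsval x \in (A + B)%VS by rewrite ABF subvsP.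
have bA x : j (be x) \in A by rewrite jBA ?memv_pi.
pose ph_fun (x : subvs_of F) : tensor (subvs_of A) 'rV[K]_2 :=
  tmul (vsproj A (al (vsval x))) (e 0) +
  tmul (vsproj A (j (be (vsval x)))) (e 1).
have ph_lin : linear ph_fun.
  move=> k x y; apply/lfunP => l; rewrite /ph_fun.
  rewrite !(add_lfunE, scale_lfunE, tmulE) !linearP /=.
  by rewrite [_ *: (k *: _)]scalerA [_ * k]mulrC -scalerA addrACA.
pose phL := GRing.isLinear.Build K (subvs_of F) (tensor (subvs_of A) 'rV[K]_2) _
  ph_fun ph_lin.
pose ph1 : {linear subvs_of F -> tensor (subvs_of A) 'rV[K]_2} :=
  HB.pack ph_fun phL.
pose ph := linfun ph1; have phE x : ph x = ph_fun x by rewrite lfunE.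
have ph0 : lker ph == 0%VS.
  rewrite -subv0; apply/subvP => x; rewrite memv_ker phE memv0 => /eqP phx.
  have l_lin i : linear (fun w : 'rV[K]_2 => w 0 i : K^o).
    by move=> k u v; rewrite !mxE.
  pose lL i := GRing.isLinear.Build K 'rV[K]_2 K^o _ _ (l_lin i).
  pose l1 i : {linear 'rV[K]_2 -> K^o} :=
    HB.pack (fun w : 'rV[K]_2 => w 0 i : K^o) (lL i).
  have lE i k : linfun (l1 i) (e k) = (i == k)%:R.
    by rewrite lfunE /= mxE eqxx.
  have /lfunP phx0 := phx.
  have alx : al (vsval x) = 0.
    have /(congr1 vsval) := phx0 (linfun (l1 0)).
    rewrite !lfunE /= !tmulE !lE scale1r scale0r addr0 /=.
    by rewrite vsprojK ?memv_pi.
  have bex : be (vsval x) = 0.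
    apply: j0; first by rewrite (subvP BF) ?memv_pi.
    have /(congr1 vsval) := phx0 (linfun (l1 1)).
    rewrite !lfunE /= !tmulE !lE scale1r scale0r add0r /=.
    by rewrite vsprojK ?bA.
  apply/eqP/val_inj; rewrite /= -(daddv_pi_add AB0 (FP x)) -/al -/be.
  by rewrite alx bex addr0.
have dAB : (\dim A <= \dim B)%N.
  rewrite -(@limg_dim_eq _ _ _ j A).
    by apply/dimvS/subvP => _ /memv_imgP[x Ax ->]; apply: jAB.
  apply/eqP; rewrite -subv0; apply/subvP => x.
  rewrite memv_cap memv_ker memv0 => /andP[Ax /eqP jx]; apply/eqP/j0 => //.
  exact: (subvP AF).
have [||iso _] := @lker0_rep_iso _ _ (sub_act F)
  (tensor_act (sub_act A) (@triv_act K E 'rV[K]_2)) ph ph0.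
- rewrite dim_homv dim_dual !dim_subvs -ABF dimv_disjoint_sum //.
  have -> : \dim {:'rV[K]_2} = 2 by rewrite dimvf.
  by rewrite mul2n -addnn leq_add2l.
- move=> a ga; apply/lfunP => x; rewrite !comp_lfunE !phE /ph_fun.
  have tmul0 (v : subvs_of A) (w : 'rV[K]_2) :
      tmul v (triv_act 'rV[K]_2 a w) = 0.
    by apply/lfunP => m; rewrite tmulE !lfunE /= linear0 scale0r.
  have actA v : v \in A -> vsproj A (a v) = sub_act A a (vsproj A v).
    move=> Av; apply: val_inj; rewrite /= (sub_actE _ gA ga) !vsprojK //.
    by have /subrepP := gA; apply.
  rewrite linearD /= !tensor_act_tmul !tmul0 !addr0 (sub_actE _ gF ga).
  rewrite /al (daddv_pi_comm gA gB ga AB0) // /be (daddv_pi_comm gB gA ga BA0).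
    by rewrite (gj _ _ ga) !actA ?memv_pi ?bA.
  by rewrite addvC.
by exists ph.
Qed.

End Reps.

(** * Pairs of projectors *)

Section Projectors.
Variables (K : fieldType) (E : vectType K).
Implicit Types (p q : 'End(E)) (A B F : {vspace E}) (x y : E).

Definition projector p A B :=
  [/\ forall x, p x \in A, forall x, x - p x \in B,
      {in A, forall x, p x = x} & {in B, forall x, p x = 0}].

Lemma daddv_pi_projector A B : (A :&: B = 0)%VS -> (A + B)%VS = fullv ->
  projector (daddv_pi A B) A B.
Proof.
move=> AB0 ABf; split=> x; first exact: memv_pi.
- rewrite -{1}(@daddv_pi_add _ _ A B x) ?ABf ?memvf //.
  by rewrite addrC addKr memv_pi.
- exact: daddv_pi_id.
- exact: daddv_pi_eq0.
Qed.

Lemma projectorC p A B : projector p A B -> projector (\1 - p)%VF B A.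
Proof.
by case=> pA pB pA1 pB0; split=> x; rewrite id_subE //;
  [rewrite opprB addrC subrK | move=> /pB0 ->; rewrite subr0
  | move=> /pA1 ->; rewrite subrr].
Qed.

Lemma projector_idem p A B x : projector p A B -> p (p x) = p x.
Proof. by case=> pA _ pA1 _; rewrite pA1. Qed.

End Projectors.

Section ProjectorsAndForms.
Variables (K : fieldType) (E : vectType K).

(** In both entries only the component in one summand survives:
    form (p x) y and form x (y - q y) are both form (p x) (y - q y). *)
Lemma projector_adjoint (eps : bool)
    (form : {hermitian E for eps & idfun}) (p q : 'End(E)) A0 A1 B0 B1 :
    projector p A0 A1 -> projector q B0 B1 ->
    (A0 <= orthov form B0)%VS -> (A1 <= orthov form B1)%VS ->
  forall x y, form (p x) y = form x (y - q y).
Proof.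
move=> [pA pB _ _] [qA qB _ _] /orthovP o0 /orthovP o1 x y.
rewrite -{1}[y](subrKC (q y)) linearDr /= o0 ?pA ?qA // add0r.
by rewrite -{2}[x](subrKC (p x)) linearDl /= (o1 (x - p x)) ?pB ?qB // addr0.
Qed.

Lemma commutant_projector (g : {vspace 'End(E)}) p A B :
    projector p A B -> subrep g A -> subrep g B ->
  commutant g p.
Proof.
move=> [pA pB pA1 pB0] /subrepP gA /subrepP gB a x ga.
rewrite -{1}[x](subrKC (p x)) (linearD a) (linearD p) /= pA1; last exact: gA.
by rewrite (pB0 (a (x - p x))) ?addr0 //; apply: gB.
Qed.

End ProjectorsAndForms.

Section TwoProjectors.
Variables (K : fieldType) (E : vectType K) (p q : 'End(E)).
Variables A0 A1 B0 B1 : {vspace E}.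
Hypotheses (pP : projector p A0 A1) (qP : projector q B0 B1).
Implicit Types (F : {vspace E}) (x y : E).

Let d : 'End(E) := p - q.

Let dE x : d x = p x - q x. Proof. by rewrite add_lfunE opp_lfunE. Qed.
Let pp x : p (p x) = p x. Proof. exact: projector_idem pP. Qed.
Let qq x : q (q x) = q x. Proof. exact: projector_idem qP. Qed.

Lemma projB_projl x : d (p x) = d x - q (d x).
Proof. by rewrite !dE pp linearB /= qq; vector_ring. Qed.

Lemma projB_projr x : d (q x) = d x - p (d x).
Proof. by rewrite !dE qq linearB /= pp; vector_ring. Qed.

(** Modulo F, a vector of either intersection is fixed by both p and q, or
    killed by both; conversely p x and q x agree modulo F when d x lies in F,
    and x = p x + (x - p x). *)
Lemma projB_preim F :
    {in F, forall x, p x \in F} -> {in F, forall x, q x \in F} ->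
  ((F + A0) :&: (F + B0) + (F + A1) :&: (F + B1))%VS = (d @^-1: F)%VS.
Proof.
move=> pF qF; case: pP qP => pA pB pA1 pB0 [qA qB qA1 qB0].
apply/eqP; rewrite eqEsubv subv_add -andbA; apply/and3P; split.
- apply/subvP => x; rewrite memv_cap -memv_preim dE => /andP[].
  move=> /memv_addP[f Ff [a Aa xE]] /memv_addP[h Fh [b Bb xE']].
  rewrite {1}xE xE' (linearD p) (linearD q) /= (pA1 _ Aa) (qA1 _ Bb).
  have -> : p f + a - (q h + b) = p f - f - (q h - h) + (f + a) - (h + b).
    by vector_ring.
  by rewrite -xE -xE' addrK !(rpredB, pF, qF).
- apply/subvP => x; rewrite memv_cap -memv_preim dE => /andP[].
  move=> /memv_addP[f Ff [a Aa xE]] /memv_addP[h Fh [b Bb xE']].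
  rewrite {1}xE xE' (linearD p) (linearD q) /= (pB0 _ Aa) (qB0 _ Bb) !addr0.
  by rewrite rpredB ?pF ?qF.
- apply/subvP => x; rewrite -memv_preim dE => Fdx.
  rewrite -[x](subrKC (p x)).
  apply: memv_add; rewrite memv_cap; apply/andP; split.
  + by rewrite (subvP (addvSr F A0)).
  + by rewrite -[p x](subrK (q x)) memv_add.
  + by rewrite (subvP (addvSr F A1)).
  + have -> : x - p x = - (p x - q x) + (x - q x) by vector_ring.
    by rewrite memv_add ?rpredN.
Qed.

(** If x = a + b = a' + b' are the two decompositions, then p x = p b' = d b'
    since q b' = p a' = 0, while x - p x = b - p b = - d b since q b = b; hence
    x = d (b' - b). *)
Lemma projB_img F :
    {in F, forall x, p x \in F} -> {in F, forall x, q x \in F} ->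
  ((F :&: A0 + F :&: B0) :&: (F :&: A1 + F :&: B1))%VS = (d @: F)%VS.
Proof.
move=> pF qF; case: pP qP => pA pB pA1 pB0 [qA qB qA1 qB0].
apply/eqP; rewrite eqEsubv; apply/andP; split; apply/subvP => x.
- rewrite memv_cap => /andP[/memv_addP[a aFA [b bFB xE]]].
  move=> /memv_addP[a' aFA' [b' bFB' xE']]; move: aFA bFB aFA' bFB'.
  rewrite !memv_cap => /andP[Fa Aa] /andP[Fb Bb] /andP[Fa' Aa'] /andP[Fb' Bb'].
  have -> : x = d (b' - b); last by rewrite memv_img ?rpredB.
  have pb' : p b' = p x by rewrite xE' linearD /= (pB0 _ Aa') add0r.
  rewrite linearB /= !dE (qA1 _ Bb) (qB0 _ Bb') pb' xE linearD /= (pA1 _ Aa).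
  by vector_ring.
- case/memv_imgP => y Fy ->; rewrite dE memv_cap; apply/andP; split.
    by rewrite memv_add ?rpredN ?memv_cap ?pF ?pA ?qF ?qA.
  have -> : p y - q y = - (y - p y) + (y - q y) by vector_ring.
  by rewrite memv_add ?rpredN ?memv_cap ?pB ?qB ?rpredB ?pF ?qF.
Qed.

Lemma kerX_proj_stable n :
  {in kerX d n, forall x, p x \in kerX d n} /\
  {in kerX d n, forall x, q x \in kerX d n}.
Proof.
elim: n => [|n [IHp IHq]].
  by split=> x /=; rewrite !memv0 => /eqP->; rewrite linear0.
by split=> x; rewrite /= -!memv_preim => dx;
  rewrite ?projB_projl ?projB_projr rpredB ?IHp ?IHq.
Qed.

End TwoProjectors.

Section ProjectorPair.
Variables (K : fieldType) (E : vectType K) (p q : 'End(E)).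
Variables A0 A1 B0 B1 : {vspace E}.
Hypotheses (pP : projector p A0 A1) (qP : projector q B0 B1).
Implicit Types (F : {vspace E}) (x y : E).

Let d : 'End(E) := p - q.
Let c : 'End(E) := p - (\1%VF - q).

Let dE x : d x = p x - q x. Proof. by rewrite add_lfunE opp_lfunE. Qed.
Let cE x : c x = p x - (x - q x).
Proof. by rewrite !(add_lfunE, opp_lfunE, id_lfunE). Qed.
Let pp x : p (p x) = p x. Proof. exact: projector_idem pP. Qed.
Let qq x : q (q x) = q x. Proof. exact: projector_idem qP. Qed.

Lemma proj_circle x : c (c x) + d (d x) = x.
Proof. by rewrite !cE !dE !linearB /= !pp !qq; vector_ring. Qed.

Lemma proj_anticomm x : c (d x) = - d (c x).
Proof. by rewrite !cE !dE !linearB /= !pp !qq; vector_ring. Qed.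

Lemma proj_cd_projl x : c (d (p x)) = c (d x) - p (c (d x)).
Proof.
rewrite (projB_projl pP qP) linearB /=; congr (_ - _).
by rewrite !cE !linearB /= qq pp; vector_ring.
Qed.

Lemma proj_cd_projr x : c (d (q x)) = c (d x) - q (c (d x)).
Proof.
rewrite (projB_projr pP qP) linearB /=; congr (_ - _).
by rewrite !cE !linearB /= qq pp; vector_ring.
Qed.

Lemma imX_proj_stable n :
  {in imX (c \o d)%VF n, forall x, p x \in imX (c \o d)%VF n} /\
  {in imX (c \o d)%VF n, forall x, q x \in imX (c \o d)%VF n}.
Proof.
elim: n => [|n [IHp IHq]]; first by split=> x _; rewrite memvf.
split=> _ /= /memv_imgP[y Fy ->].
  have -> : p ((c \o d)%VF y) = (c \o d)%VF (y - p y).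
    by rewrite linearB /= !comp_lfunE proj_cd_projl opprB addrC subrK.
  by rewrite memv_img ?rpredB ?IHp.
have -> : q ((c \o d)%VF y) = (c \o d)%VF (y - q y).
  by rewrite linearB /= !comp_lfunE proj_cd_projr opprB addrC subrK.
by rewrite memv_img ?rpredB ?IHq.
Qed.

(** If x = d a = c b then c^2 x = - c d c a and d^2 x = c d^2 b, and these add
    up to x. *)
Lemma cap_img F :
    {in F, forall x, p x \in F} -> {in F, forall x, q x \in F} ->
  ((d @: F) :&: (c @: F))%VS = ((c \o d)%VF @: F)%VS.
Proof.
move=> pF qF.
have dF : {in F, forall x, d x \in F}.
  by move=> x Fx; rewrite dE rpredB ?pF ?qF.
have cF : {in F, forall x, c x \in F}.
  by move=> x Fx; rewrite cE !rpredB ?pF ?qF.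
apply/vspaceP => x; rewrite memv_cap; apply/andP/memv_imgP; last first.
  case=> y Fy ->; rewrite comp_lfunE; split; last by rewrite memv_img ?dF.
  by rewrite proj_anticomm -linearN memv_img ?rpredN ?cF.
case=> /memv_imgP[a Fa xa] /memv_imgP[b Fb xb].
exists (d b - c a); first by rewrite rpredB ?dF ?cF.
have ccx : c (c x) = - c (d (c a)) by rewrite xa proj_anticomm linearN.
have ddx : d (d x) = c (d (d b)).
  by rewrite xb -[d (c b)]opprK -proj_anticomm linearN -proj_anticomm.
by rewrite -[LHS]proj_circle ccx ddx comp_lfunE !linearB addrC.
Qed.

End ProjectorPair.

(** * The filtrations in terms of two projectors *)

Section Stages.
Variables (K : fieldType) (E : vectType K) (V W : 'I_2 -> {vspace E}).
Let N := \dim {:E}.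

Lemma lift_ord0_2 : lift ord0 ord0 = 1 :> 'I_2.
Proof. exact: val_inj. Qed.

(** For s = tau the endomorphism q is the projector onto W 1 along W 0, which
    turns p - q into c. *)
Lemma Fstage_kerX (s : 'S_2) p q n :
    projector p (V 0) (V 1) -> projector q (W (s 0)) (W (s 1)) ->
  Fstage V W s n = kerX (p - q) n.
Proof.
move=> pP qP; elim: n => //= n ->.
have [pF qF] := kerX_proj_stable pP qP n.
by rewrite !big_ord_recl big_ord0 addv0 lift_ord0_2 (projB_preim pP qP).
Qed.

Lemma Fsum_kerX (s : 'S_2) p q :
    projector p (V 0) (V 1) -> projector q (W (s 0)) (W (s 1)) ->
  Fsum V W s = kerX (p - q) N /\
  forall n, (kerX (p - q) n <= kerX (p - q) N)%VS.
Proof.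
move=> pP qP; have FE n := Fstage_kerX n pP qP.
have FN : Fsum V W s = kerX (p - q) N.
  apply/eqP; rewrite eqEsubv -{2}FE Fstage_sub andbT.
  by apply/subv_sumP => n _; rewrite FE kerX_leq // -ltnS.
by split=> // n; rewrite -FN -FE Fstage_sub.
Qed.

Variables p q : 'End(E).
Hypotheses (pP : projector p (V 0) (V 1)) (qP : projector q (W 0) (W 1)).
Let u := ((p - (\1%VF - q)) \o (p - q))%VF.

(** The four terms of the intersection pair up as (i, j) = (0, 0), (1, 1),
    giving the image by d, and (0, 1), (1, 0), giving the image by c. *)
Lemma Ftilde_stage_imX n : Ftilde_stage V W n = imX u n.
Proof.
elim: n => //= n ->.
have [pF qF] := imX_proj_stable pP qP n.
have qF' : {in imX u n, forall x, (\1 - q)%VF x \in imX u n}.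
  by move=> x ux; rewrite add_lfunE opp_lfunE id_lfunE rpredB ?qF.
rewrite !big_ord_recl !big_ord0 !capvf lift_ord0_2.
rewrite -(cap_img pP qP pF qF) -(projB_img pP qP pF qF).
rewrite -(projB_img pP (projectorC qP) pF qF').
by rewrite (@capv K E).[AC (2*2) ((1*4)*(2*3))].
Qed.

(** The stages are stationary, so c d maps the last one onto itself. *)
Lemma Ftilde_imX : Ftilde V W = imX u N /\ stable_inj u (Ftilde V W).
Proof.
have FN : Ftilde V W = imX u N.
  apply/eqP; rewrite eqEsubv -{1}Ftilde_stage_imX Ftilde_sub_stage /=.
  apply/subv_bigcapP => n _; rewrite Ftilde_stage_imX.
  apply/subvP => _ /imXP[y ->]; apply/imXP.
  by exists (iter (N - n) u y); rewrite -iterD subnKC // -ltnS.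
have uF : (u @: Ftilde V W <= Ftilde V W)%VS.
  rewrite FN; apply/subvP => _ /memv_imgP[_ /imXP[y ->] ->]; apply/imXP.
  by exists (u y); rewrite -iterS iterSr.
have Fu : (u @: Ftilde V W = Ftilde V W)%VS.
  apply/eqP; rewrite eqEsubv uF {2}FN -[(u @: _)%VS]/(imX u N.+1).
  by rewrite -Ftilde_stage_imX Ftilde_sub_stage.
split=> //; split=> x Fx; first by rewrite (subvP uF) ?memv_img.
have /eqP := limg_ker_dim u (Ftilde V W).
rewrite Fu -[X in _ == X]add0n eqn_add2r dimv_eq0 => /eqP ker0 ux0.
by apply/eqP; rewrite -memv0 -ker0 memv_cap Fx memv_ker ux0 eqxx.
Qed.

(** Ftilde is a fixed point of the recursion, and the right-hand side is one of
    the terms that the next stage intersects. *)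
Lemma Ftilde_sub_add i j :
  (Ftilde V W <= Ftilde V W :&: V i + Ftilde V W :&: W j)%VS.
Proof.
have [FN _] := Ftilde_imX.
rewrite {2 3}FN -Ftilde_stage_imX (subv_trans (Ftilde_sub_stage V W N.+1)) //=.
apply: (@bigcapv_inf _ _ _ i) => //; exact: (@bigcapv_inf _ _ _ j).
Qed.

End Stages.

(** * The decomposition *)

Section Decomposition.
Variables (K : fieldType) (E : vectType K) (g : {vspace 'End(E)}) (eps : bool).
Variable form : {hermitian E for eps & idfun}.
Hypothesis two : 2%:R != 0 :> K.
Hypothesis form_nondeg : nondegenerate form.
Hypothesis form_inv : {in g, forall (a : 'End(E)) (x y : E),
  form (a x) y + form x (a y) = 0}.
Variable V : 'I_2 -> {vspace E}.
Hypothesis V_cap : (V 0%R :&: V 1%R = 0)%VS.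
Hypothesis V_full : (V 0%R + V 1%R)%VS = fullv.
Hypothesis V_inv : forall i : 'I_2, subrep g (V i).

Let W (i : 'I_2) := orthov form (V i).
Let N := \dim {:E}.
Let p := daddv_pi (V 0) (V 1).
Let q := daddv_pi (W 0) (W 1).
Let d := p - q.
Let c := p - (\1%VF - q).
Let u := (c \o d)%VF.
Let Fe := Fsum V W 1%g.
Let Ft := Fsum V W (tperm 0 1).
Let Fn := Ftilde V W.

Let pP : projector p (V 0) (V 1).
Proof. exact: daddv_pi_projector. Qed.

Let qP : projector q (W 0) (W 1).
Proof.
have [W_cap W_full] := orthov_complement form_nondeg V_cap V_full.
exact: daddv_pi_projector.
Qed.

Let dE x : d x = p x - q x. Proof. by rewrite add_lfunE opp_lfunE. Qed.
Let cE x : c x = p x - (x - q x).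
Proof. by rewrite !(add_lfunE, opp_lfunE, id_lfunE). Qed.

Let circle x : c (c x) + d (d x) = x. Proof. exact: proj_circle pP qP x. Qed.
Let circle' x : d (d x) + c (c x) = x. Proof. by rewrite addrC circle. Qed.
Let cdN x : c (d x) = - d (c x). Proof. exact: proj_anticomm pP qP x. Qed.
Let dcN x : d (c x) = - c (d x). Proof. by rewrite cdN opprK. Qed.

(* The adjoint of p is 1 - q, because W i is the orthogonal of V i. *)
Let d_adj x y : form (d x) y = form x (d y).
Proof.
have VW i : (V i <= orthov form (W i))%VS by rewrite orthov_sym.
rewrite !dE linearBl linearBr /=.
rewrite (projector_adjoint pP qP) // (projector_adjoint qP pP) //.
by rewrite !linearBr /=; ring.
Qed.

Let c_adj x y : form (c x) y = form x ((- c) y).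
Proof.
have VW i : (V i <= orthov form (W i))%VS by rewrite orthov_sym.
rewrite opp_lfunE !cE !(linearBl, linearNr) /= !linearBr /=.
rewrite (projector_adjoint pP qP) // (projector_adjoint qP pP) //.
rewrite !linearBr /=; ring.
Qed.

Let c_comm : commutant g c.
Proof.
apply: commutantD; first exact: commutant_projector pP (V_inv 0) (V_inv 1).
apply/commutantN/commutantD; [exact: commutant1 | apply: commutantN].
by apply: commutant_projector qP _ _; apply: subrep_orthov.
Qed.

Let d_comm : commutant g d.
Proof.
apply: commutantD; first exact: commutant_projector pP (V_inv 0) (V_inv 1).
by apply/commutantN/commutant_projector; [exact: qP | |]; apply: subrep_orthov.
Qed.

Let FeE : Fe = kerX d N /\ forall n, (kerX d n <= kerX d N)%VS.
Proof. by apply: Fsum_kerX; rewrite ?perm1. Qed.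

Let FtE : Ft = kerX c N /\ forall n, (kerX c n <= kerX c N)%VS.
Proof. by apply: Fsum_kerX; rewrite ?tpermL ?tpermR //; apply: projectorC. Qed.

Let FnE : Fn = imX u N /\ stable_inj u Fn.
Proof. exact: Ftilde_imX. Qed.

Lemma subrep_Fe : subrep g Fe.
Proof. by rewrite (proj1 FeE); apply: subrep_kerX. Qed.

Lemma subrep_Ft : subrep g Ft.
Proof. by rewrite (proj1 FtE); apply: subrep_kerX. Qed.

Lemma subrep_Fn : subrep g Fn.
Proof. by rewrite (proj1 FnE); apply/subrep_imX/commutantM. Qed.

(** c d is bijective on Fn, which contains every (c d)^N x, so E is Fn plus the
    kernel of (c d)^N; as c and d anticommute, d^N sends that kernel into Ft, on
    which d is bijective. *)
Lemma sum_full : (Fe + Ft + Fn)%VS = fullv.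
Proof.
have [FeE' _] := FeE; have [FtE' _] := FtE; have [FnE' u_inj] := FnE.
apply/eqP; rewrite eqEsubv subvf /=; apply/subvP => x _.
have : x \in (Fn + kerX u N)%VS.
  by apply: stable_inj_split => //; rewrite FnE'; apply/imXP; exists x.
rewrite addvC; apply/subvP/addvS => //; apply/subvP => y /kerXP uy.
rewrite addvC FeE' FtE'; apply: stable_inj_split.
  exact: circle_stable_inj circle' _ cdN.
apply/kerXP; have [|k ->] := @iter_skew_comp _ _ (-1) c d N y.
  by move=> z; rewrite scaleN1r.
by rewrite uy scaler0.
Qed.

Lemma Fe_orth_Ft : (Fe <= orthov form Ft)%VS.
Proof.
rewrite (proj1 FeE) (proj1 FtE); apply: (orthov_kerX _ d_adj).
exact: circle_stable_inj circle' _ cdN.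
Qed.

(** d anticommutes with c d, so it is stable on Fn; it is injective there
    because c d is. *)
Lemma Fe_orth_Fn : (Fe <= orthov form Fn)%VS.
Proof.
have [FnE' [_ u_inj]] := FnE.
rewrite (proj1 FeE); apply: (orthov_kerX _ d_adj); split=> x; last first.
  by move=> Fx dx; apply: u_inj Fx _; rewrite comp_lfunE dx linear0.
rewrite FnE'; apply: (imX_stable (s := -1)) => [y|].
  by rewrite scaleN1r !comp_lfunE cdN.
by rewrite oppr_eq0 oner_neq0.
Qed.

Lemma Ft_orth_Fn : (Ft <= orthov form Fn)%VS.
Proof.
have [FnE' [_ u_inj]] := FnE.
rewrite (proj1 FtE); apply: (orthov_kerX _ c_adj); split=> x; last first.
  rewrite opp_lfunE => Fx /eqP; rewrite oppr_eq0 => /eqP cx.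
  by apply: u_inj Fx _; rewrite comp_lfunE cdN cx linear0 oppr0.
rewrite opp_lfunE rpredN FnE'; apply: (imX_stable (s := -1)) => [y|].
  by rewrite scaleN1r !comp_lfunE dcN linearN.
by rewrite oppr_eq0 oner_neq0.
Qed.

Lemma Fe_split : exists Fp : {vspace E},
  [/\ (Fp <= Fe)%VS, subrep g Fp, (Fp <= orthov form Fp)%VS
    & exists2 phi : 'Hom((subvs_of Fp * dual (subvs_of Fp))%type, subvs_of Fe),
        rep_iso g (dsum_act (sub_act Fp) (dual_act (sub_act Fp)))
          (sub_act Fe) phi
        & forall w : subvs_of Fp, vsval (phi (w, 0)) = vsval w].
Proof.
have [FeE' kerd] := FeE; have [ip im] := one_pm_stable_inj c two N.
pose Fp := kerX (\1 - c)%VF N; pose Fm := kerX (\1 + c)%VF N.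
have pmE : (Fp + Fm)%VS = Fe by rewrite FeE'; apply: kerX_circle_split.
have comm1 := @commutant1 _ _ g.
have gFp : subrep g Fp by apply/subrep_kerX/commutantD/commutantN.
have gFm : subrep g Fm by apply/subrep_kerX/commutantD.
(* 1 + c is the adjoint of 1 - c and is invertible on Fp. *)
have isoFp : (Fp <= orthov form Fp)%VS.
  apply: (@orthov_kerX _ _ _ form _ (\1 + c)%VF _ _ _ ip) => x y.
  rewrite id_subE id_addE linearBl linearDr /= c_adj opp_lfunE.
  by rewrite linearNr opprK.
have isoFm : (Fm <= orthov form Fm)%VS.
  apply: (@orthov_kerX _ _ _ form _ (\1 - c)%VF _ _ _ im) => x y.
  by rewrite id_subE id_addE linearDl linearDr /= c_adj opp_lfunE.
exists Fp; split=> //; first by rewrite -pmE addvSl.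
apply: (hyperbolic_rep form_inv gFp gFm pmE _ isoFp isoFm).
  by apply: (stable_inj_disjoint N ip).
apply: (orthov_summand form_nondeg (B := (Ft + Fn)%VS)).
  by rewrite addvA sum_full.
by rewrite orthovD Fe_orth_Ft Fe_orth_Fn.
Qed.

Lemma Ft_split : exists Fp Fm : {vspace E},
  [/\ subrep g Fp, subrep g Fm, (Fp :&: orthov form Fp = 0)%VS,
      (Fp + Fm)%VS = Ft /\ directv (Fp + Fm)
    & (Fp <= orthov form Fm)%VS].
Proof.
have [FtE' kerc] := FtE; have [ip im] := one_pm_stable_inj d two N.
pose Fp := kerX (\1 - d)%VF N; pose Fm := kerX (\1 + d)%VF N.
have pmE : (Fp + Fm)%VS = Ft by rewrite FtE'; apply: kerX_circle_split.
have comm1 := @commutant1 _ _ g.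
(* 1 - d is its own adjoint and is invertible on Fm. *)
have oFpm : (Fp <= orthov form Fm)%VS.
  apply: (@orthov_kerX _ _ _ form _ (\1 - d)%VF _ _ _ im) => x y.
  by rewrite !id_subE linearBl linearBr /= d_adj.
have FpF : (Fp <= Ft)%VS by rewrite -pmE addvSl.
exists Fp, Fm; split=> //.
- by apply/subrep_kerX/commutantD/commutantN.
- by apply/subrep_kerX/commutantD.
- apply: (orthov_summand form_nondeg (B := (Fm + (Fe + Fn))%VS)).
    by rewrite addvA pmE -sum_full addvA [(Ft + Fe)%VS]addvC.
  rewrite !orthovD oFpm (subv_trans FpF) ?(subv_trans FpF) ?Ft_orth_Fn //.
  by rewrite orthov_sym Fe_orth_Ft.
split=> //; apply/directv_addP; exact: (stable_inj_disjoint N ip).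
Qed.

Lemma Fn_split : exists F0 : {vspace E},
  [/\ (F0 <= Fn)%VS, subrep g F0, (F0 :&: orthov form F0 = 0)%VS
    & exists phi : 'Hom(subvs_of Fn, tensor (subvs_of F0) 'rV[K]_2),
        rep_iso g (sub_act Fn)
          (tensor_act (sub_act F0) (@triv_act K E 'rV[K]_2)) phi].
Proof.
have [FnE' [uF u_inj]] := FnE; have [pV pV' pV1 pV0] := pP.
have pF : {in Fn, forall x, p x \in Fn}.
  by rewrite FnE'; have [] := imX_proj_stable pP qP N.
have up x : u (p x) = u x - p (u x).
  by rewrite !comp_lfunE (proj_cd_projl pP qP).
pose F0 := (Fn :&: V 0%R)%VS; pose F1 := (Fn :&: V 1)%VS.
have gF i : subrep g (Fn :&: V i)%VS.
  by apply: subrep_cap => //; apply: subrep_Fn.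
have F01 : (F0 + F1)%VS = Fn.
  apply/eqP; rewrite eqEsubv subv_add !capvSl /=; apply/subvP => x Fx.
  by rewrite -[x](subrKC (p x)) memv_add ?memv_cap ?pV ?pV' ?andbT ?rpredB ?pF.
exists F0; split; first exact: capvSl.
- exact: gF.
- apply: (orthov_summand form_nondeg (B := (Fn :&: W 0%R + (Fe + Ft))%VS)).
    apply/eqP; rewrite eqEsubv subvf /= -sum_full addvA [X in (X <= _)%VS]addvC.
    by apply: addvS => //; apply: (Ftilde_sub_add pP qP).
  have oF0 : (F0 <= orthov form (Fn :&: W 0%R)%VS)%VS.
    have /orthovP oVW : (V 0%R <= orthov form (W 0%R))%VS by rewrite orthov_sym.
    apply/orthovP => x y /memv_capP[_ Vx] /memv_capP[_ Wy]; exact: oVW.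
  have F0F : (F0 <= Fn)%VS by apply: capvSl.
  rewrite !orthovD oF0 /= !(subv_trans F0F) // orthov_sym.
    exact: Ft_orth_Fn.
  exact: Fe_orth_Fn.
(* p (u x) = u (x - p x), so u exchanges the image and the kernel of p. *)
- apply: (double_rep (gF 0) (gF 1) F01 (j := u)) => //.
  + by apply/eqP; rewrite -subv0 -V_cap capvS ?capvSr.
  + exact: commutantM c_comm d_comm.
  + move=> x; rewrite !memv_cap => /andP[Fx Vx]; rewrite uF //=.
    by have := up x; rewrite (pV1 _ Vx) => ->; apply: pV'.
  + move=> x; rewrite !memv_cap => /andP[Fx Vx]; rewrite uF //=.
    by have := up x; rewrite (pV0 _ Vx) linear0 => /esym/subr0_eq ->.
Qed.

End Decomposition.

Theorem theorem36 (K : fieldType) (charK : 2%N \notin [pchar K])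
  (E : vectType K) (g : {vspace 'End(E)}) (g_lie : lie_subalgebra g)
  (eps : bool) (form : {hermitian E for eps & idfun})
  (form_nondeg : nondegenerate form)
  (form_inv : {in g, forall (a : 'End(E)) (x y : E),
                 form (a x) y + form x (a y) = 0})
  (V : 'I_2 -> {vspace E})
  (V_direct : directv (\sum_(i < 2) V i))
  (V_full : (\sum_(i < 2) V i)%VS = fullv)
  (V_inv : forall i : 'I_2, subrep g (V i)) :
  let W := fun i : 'I_2 => orthov form (V i) in
  let Fe := Fsum V W 1%g in
  let Ft := Fsum V W (tperm 0 1) in
  let Fn := Ftilde V W in
  [/\ subrep g Fe, subrep g Ft & subrep g Fn] /\
  [/\ (* (i) *)
      [/\ direct_sum3 fullv Fe Ft Fn,
          (Fe <= orthov form Ft)%VS, (Fe <= orthov form Fn)%VS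
        & (Ft <= orthov form Fn)%VS],
      (* (ii) *)
      exists Fp : {vspace E},
        [/\ (Fp <= Fe)%VS, subrep g Fp, (Fp <= orthov form Fp)%VS
          & exists2 phi : 'Hom((subvs_of Fp * dual (subvs_of Fp))%type,
                               subvs_of Fe),
              rep_iso g (dsum_act (sub_act Fp) (dual_act (sub_act Fp)))
                (sub_act Fe) phi
              & forall u : subvs_of Fp, vsval (phi (u, 0)) = vsval u],
      (* (iii) *)
      exists Fp Fm : {vspace E},
        [/\ subrep g Fp, subrep g Fm, (Fp :&: orthov form Fp = 0)%VS,
            (Fp + Fm)%VS = Ft /\ directv (Fp + Fm)
          & (Fp <= orthov form Fm)%VS]
    & (* (iv) *)
      exists F0 : {vspace E},
        [/\ (F0 <= Fn)%VS, subrep g F0, (F0 :&: orthov form F0 = 0)%VS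
          & exists phi : 'Hom(subvs_of Fn, tensor (subvs_of F0) 'rV[K]_2),
              rep_iso g (sub_act Fn)
                (tensor_act (sub_act F0) (@triv_act K E 'rV[K]_2)) phi]].
Proof.
have two : 2%:R != 0 :> K by move: charK; rewrite inE.
have V_sum : (\sum_(i < 2) V i = V 0%R + V 1%R)%VS.
  by rewrite !big_ord_recl big_ord0 addv0 lift_ord0_2.
have V_cap : (V 0%R :&: V 1%R = 0)%VS.
  have /directv_sumP/(_ 0 isT) V0 := V_direct.
  apply/eqP; rewrite -subv0 -[X in (_ <= X)%VS]V0 capvS //.
  exact: (sumv_sup 1).
rewrite V_sum in V_full; move=> W Fe Ft Fn.
split; first by split; [exact: subrep_Fe | exact: subrep_Ft | exact: subrep_Fn].
split; [|exact: Fe_split|exact: Ft_split|exact: Fn_split].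
have oet : (Fe <= orthov form Ft)%VS by exact: Fe_orth_Ft.
have oen : (Fe <= orthov form Fn)%VS by exact: Fe_orth_Fn.
have otn : (Ft <= orthov form Fn)%VS by exact: Ft_orth_Fn.
split=> //; apply: (direct_sum3_orthov form_nondeg) => //; exact: sum_full.
Qed.
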